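(* Let $1\le p\le n-1$ and let $J$ be an $n\times n$ symmetric tri-diagonal matrix with diagonal entries $b_1,\ldots,b_n$ and off-diagonal entries $a_1,\ldots,a_{n-1}$ satisfying $\operatorname{Im}b_1>0$, $b_k\in\mathbb{R}$ for $k=2,\ldots,n$, $a_k>0$ for $k\neq p$, and $a_p=0$. Write $c_{2k-1}=b_k$ and $c_{2k}=a_k$. Suppose that the $p$ non-real eigenvalues $z_1,\ldots,z_p$ of $J$, counted with algebraic multiplicity, and the distinct real eigenvalues $z_{p+1},\ldots,z_n$ of $J$ are given, as well as the entries $c_{p+n+1},\ldots,c_{2n-1}$. Then these data uniquely determine the entries $c_1,\ldots,c_{p+n}$; that is, any two $n\times n$ symmetric tri-diagonal matrices, each having diagonal entries $b_1,\ldots,b_n$ and off-diagonal entries $a_1,\ldots,a_{n-1}$ that satisfy $\operatorname{Im}b_1>0$, $b_k\in\mathbb{R}$ for $k=2,\ldots,n$, $a_k>0$ for $k\neq p$, and $a_p=0$ (with the same $p$), which have the same non-real eigenvalues $z_1,\ldots,z_p$ counted with algebraic multiplicity, the same distinct real eigenvalues $z_{p+1},\ldots,z_n$, and the same entries $c_{p+n+1},\ldots,c_{2n-1}$ coincide.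
   Context: The symmetric tri-diagonal matrix with diagonal entries $b_1,\ldots,b_n$ and off-diagonal entries $a_1,\ldots,a_{n-1}$ is the $n\times n$ matrix with $b_k$ in position $(k,k)$, with $a_k$ in both positions $(k,k+1)$ and $(k+1,k)$, and zeros elsewhere. Its entries are regarded as a single sequence $\{c_k\}_{k=1}^{2n-1}$, $c_{2k-1}=b_k$, $c_{2k}=a_k$. *)

(* Defs.v *)
From mathcomp Require Import all_boot all_order all_algebra.
From mathcomp Require Import reals complex.

Set Implicit Arguments.
Unset Strict Implicit.
Unset Printing Implicit Defensive.

Import Order.TTheory GRing.Theory Num.Theory.
Local Open Scope ring_scope.
Local Open Scope complex_scope.

(* The sequences b, a and c are indexed from 1; the values of b outside
   [1, n] and of a outside [1, n-1] do not occur in the matrix. Rows and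
   columns are ordinals, indexed from 0. *)
Definition tridiag (C : nzRingType) (n : nat) (b a : nat -> C) : 'M[C]_n :=
  \matrix_(i, j)
    if i == j then b i.+1
    else if j == i.+1 :> nat then a i.+1
    else if i == j.+1 :> nat then a j.+1
    else 0.

(* c_(2k-1) = b_k and c_(2k) = a_k *)
Definition centry (C : Type) (b a : nat -> C) (k : nat) : C :=
  if odd k then b k.+1./2 else a k./2.

(* In the order of R[i], 0 < z means that z is real and positive. *)
Record admissible (R : realType) (n p : nat) (b a : nat -> R[i]) : Prop :=
  Admissible {
    adm_Im_b1 : 0 < complex.Im (b 1%N);
    adm_b_real : forall k, (2 <= k <= n)%N -> b k \is Num.real;
    adm_a_gt0 : forall k, (1 <= k <= n.-1)%N -> k != p -> 0 < a k;
    adm_a_p : a p = 0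
  }.

(* The list z consists of the non-real eigenvalues of J, each one repeated
   according to its algebraic multiplicity. *)
Definition nonreal_eigenvalues (R : realType) (n : nat) (J : 'M[R[i]]_n)
    (z : seq R[i]) : Prop :=
  forall w, count_mem w z =
    if w \is Num.real then 0%N else mup w (char_poly J).

Definition distinct_real_eigenvalues (R : realType) (n : nat)
    (J : 'M[R[i]]_n) (x : seq R[i]) : Prop :=
  uniq x /\ forall w, (w \in x) = (w \is Num.real) && eigenvalue J w.

(* Main.v *)
(* Since a_p = 0, J is the direct sum of a p x p block J1 containing b_1 and a
   real Jacobi block J2. The roots of char J2 are real, so counting forces
   char J1 = prod (X - z_i) and char J2 = prod (X - x_i).
   J1: write char J1 = (X - b_1) Q - a_1^2 S with Q and S real and monic; then
   the difference of char J1 and its conjugate is a scalar multiple of Q, which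
   determines Q, and from char J1 and Q the entries are read off one at a time.
   J2 (Hochstadt): expand char J2 = A B - a^2 A1 B1 along the cut between the
   unknown upper half (A, A1) and the known lower half (B, B1). The difference
   of two solutions gives (A - A') B = G B1 with B, B1 coprime and
   deg G < deg B, so G = 0 and A = A', A1 = A1'; again the entries are read
   off one at a time. *)
Require Import Defs.
From mathcomp Require Import all_boot all_order all_algebra.
From mathcomp Require Import reals complex.
From mathcomp Require Import ring zify.

Set Implicit Arguments.
Unset Strict Implicit.
Unset Printing Implicit Defensive.

Import Order.TTheory GRing.Theory Num.Theory.
Local Open Scope ring_scope.

(** * Continuants and determinants of tri-diagonal matrices *)

Section Continuant.
Variables (S : comNzRingType) (d e : nat -> S).

(** Here [l] is the size of a diagonal block and [s] the number of rows above it; the recursion is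
    expansion along the first row. *)
Fixpoint continuant (l s : nat) : S :=
  if l is l1.+1 then
    d s.+1 * continuant l1 s.+1
    - (if l1 is l2.+1 then e s.+1 ^+ 2 * continuant l2 s.+2 else 0)
  else 1.

Lemma continuantSS l s : continuant l.+2 s =
  d s.+1 * continuant l.+1 s.+1 - e s.+1 ^+ 2 * continuant l s.+2.
Proof. by []. Qed.

(** Laplace expansion along a cut: a term of the determinant either stays inside the two blocks or
    crosses the cut once each way, which gives the square of the entry of [e] there. *)
Lemma continuant_split i j s :
  continuant (i.+1 + j.+1) s =
    continuant i.+1 s * continuant j.+1 (s + i.+1)
    - e (s + i.+1)%N ^+ 2 * (continuant i s * continuant j (s + i.+2)).
Proof.
elim/ltn_ind: i s => -[|[|i]] IH s.
- by rewrite add1n continuantSS addn1 addn2 /=; ring.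
- rewrite [LHS](_ : _ = d s.+1 * continuant (1 + j.+1) s.+1
    - e s.+1 ^+ 2 * continuant j.+1 s.+2) // IH //.
  rewrite continuantSS !addSnnS addn2 /=; ring.
- rewrite [LHS](_ : _ = d s.+1 * continuant (i.+2 + j.+1) s.+1
    - e s.+1 ^+ 2 * continuant (i.+1 + j.+1) s.+2) // !IH //.
  rewrite (continuantSS i.+1) (continuantSS i s) (continuantSS i s.+1) !addSnnS; ring.
Qed.

Lemma continuantSSr l s : continuant l.+2 s =
  continuant l.+1 s * d (s + l.+2)%N - e (s + l.+1)%N ^+ 2 * continuant l s.
Proof.
by rewrite -[l.+2]addn1 continuant_split /= subr0 !mulr1 -addnS addn1.
Qed.

Lemma det_tridiag l s :
  \det (tridiag l (fun k => d (s + k)%N) (fun k => e (s + k)%N)) = continuant l s.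
Proof.
elim/ltn_ind: l s => -[|[|l]] IH s; first by rewrite det_mx00.
  by rewrite det_mx11 !mxE /= addn1 mulr1 subr0.
rewrite continuantSS; set c1 := continuant l.+1 _; set c2 := continuant l _.
set J := tridiag _ _ _.
have minor m t : row' ord0 (col' ord0 (tridiag m.+1 (fun k => d (t + k)%N)
    (fun k => e (t + k)%N))) =
    tridiag m (fun k => d (t.+1 + k)%N) (fun k => e (t.+1 + k)%N).
  by apply/matrixP => i j; rewrite !mxE /= !addSnnS.
rewrite (expand_det_row _ ord0) big_ord_recl big_ord_recl big1 ?addr0; last first.
  by move=> i _; rewrite !mxE /= mul0r.
rewrite /cofactor minor IH // -/c1 /= addn0 expr0 mul1r.
rewrite (expand_det_col _ ord0) big_ord_recl big1 ?addr0; last first.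
  by move=> i _; rewrite !mxE /= mul0r.
rewrite /cofactor.
(* Deleting column 1 and then column 0 leaves the same columns as deleting column 0 twice. *)
have -> : row' ord0 (col' ord0 (row' ord0 (col' (lift ord0 ord0) J))) =
    row' ord0 (col' ord0 (row' ord0 (col' ord0 J))).
  by apply/matrixP => i j; rewrite !mxE /=.
rewrite !minor IH // -/c2 !mxE /= !addn1 expr0 expr1; ring.
Qed.

End Continuant.

(* The characteristic polynomial of the l x l diagonal block formed by the rows
   s+1, ..., s+l (indexed from 1). *)
Definition jacobi_poly (F : fieldType) (b a : nat -> F) : nat -> nat -> {poly F} :=
  continuant (fun k => 'X - (b k)%:P) (fun k => - (a k)%:P).

Arguments jacobi_poly : simpl never.

(** * Characteristic polynomials of diagonal blocks *)

Section JacobiPoly.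
Variable F : fieldType.
Implicit Types (b a : nat -> F) (P Q : {poly F}).

Lemma jacobi_polySS b a l s : jacobi_poly b a l.+2 s =
  ('X - (b s.+1)%:P) * jacobi_poly b a l.+1 s.+1
  - a s.+1 ^+ 2 *: jacobi_poly b a l s.+2.
Proof. by rewrite /jacobi_poly continuantSS sqrrN -rmorphXn mul_polyC. Qed.

Lemma jacobi_polySSr b a l s : jacobi_poly b a l.+2 s =
  ('X - (b (s + l.+2)%N)%:P) * jacobi_poly b a l.+1 s
  - a (s + l.+1)%N ^+ 2 *: jacobi_poly b a l s.
Proof.
by rewrite /jacobi_poly continuantSSr sqrrN -rmorphXn mul_polyC mulrC.
Qed.

Lemma jacobi_poly0 b a s : jacobi_poly b a 0 s = 1.
Proof. by []. Qed.

Lemma jacobi_poly1 b a s : jacobi_poly b a 1 s = 'X - (b s.+1)%:P.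
Proof. by rewrite /jacobi_poly /= mulr1 subr0. Qed.

Lemma jacobi_poly_split b a i j s : jacobi_poly b a (i.+1 + j.+1) s =
  jacobi_poly b a i.+1 s * jacobi_poly b a j.+1 (s + i.+1)
  - a (s + i.+1)%N ^+ 2 *:
    (jacobi_poly b a i s * jacobi_poly b a j (s + i.+2)).
Proof.
by rewrite /jacobi_poly continuant_split sqrrN -rmorphXn mul_polyC.
Qed.

Lemma jacobi_poly_monic_size b a l s :
  jacobi_poly b a l s \is monic /\ size (jacobi_poly b a l s) = l.+1.
Proof.
elim/ltn_ind: l s => -[|[|l]] IH s.
- by rewrite jacobi_poly0 monic1 size_poly1.
- by rewrite jacobi_poly1 monicXsubC size_XsubC.
rewrite jacobi_polySS.
have [mQ sQ] := IH l.+1 (ltnSn _) s.+1.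
have [_ sS] := IH l (ltnW (ltnSn _)) s.+2.
have sP : size (('X - (b s.+1)%:P) * jacobi_poly b a l.+1 s.+1) = l.+3.
  by rewrite size_monicM ?monicXsubC ?monic_neq0 // size_XsubC sQ.
have lt : (size (- (a s.+1 ^+ 2 *: jacobi_poly b a l s.+2)) < l.+3)%N.
  by rewrite size_polyN (leq_ltn_trans (size_scale_leq _ _)) // sS; lia.
split; last by rewrite size_polyDl sP.
rewrite monicE lead_coefDl ?sP // -monicE.
by rewrite monicMl ?monicXsubC.
Qed.

Lemma jacobi_poly_monic b a l s : jacobi_poly b a l s \is monic.
Proof. by case: (jacobi_poly_monic_size b a l s). Qed.

Lemma size_jacobi_poly b a l s : size (jacobi_poly b a l s) = l.+1.
Proof. by case: (jacobi_poly_monic_size b a l s). Qed.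

Lemma char_poly_tridiag b a n :
  char_poly (tridiag n b a) = jacobi_poly b a n 0.
Proof.
rewrite /jacobi_poly -det_tridiag /char_poly; congr (\det _).
apply/matrixP => i j; rewrite !mxE.
case: ifP => // _; rewrite mulr0n add0r.
by case: ifP => _; [|case: ifP => _] => //; rewrite oppr0.
Qed.

(** The three-term recursion is a Euclidean step whose remainder is a nonzero multiple of the next
    polynomial, so the gcd descends to a constant. *)
Lemma coprimep_jacobi_poly b a l s :
  (forall k, (s < k <= s + l)%N -> a k != 0) ->
  coprimep (jacobi_poly b a l.+1 s) (jacobi_poly b a l s.+1).
Proof.
elim: l s => [|l IH] s ha; first by rewrite jacobi_poly0 coprimep1.
rewrite jacobi_polySS coprimep_sym coprimep_addl_mul -scaleNr coprimepZr.
  by apply: IH => k hk; apply: ha; lia.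
by rewrite oppr_eq0 expf_neq0 // ha //; lia.
Qed.

Lemma eq_jacobi_poly b a b' a' l s :
  (forall k, (s < k <= s + l)%N -> b k = b' k) ->
  (forall k, (s < k < s + l)%N -> a k = a' k) ->
  jacobi_poly b a l s = jacobi_poly b' a' l s.
Proof.
elim/ltn_ind: l s => -[|[|l]] IH s hb ha //.
  by rewrite !jacobi_poly1 hb //; lia.
rewrite !jacobi_polySS hb ?ha; [|lia..].
by rewrite !(IH l.+1, IH l) // => k hk; (apply: hb || apply: ha); lia.
Qed.

Lemma size_monicB P Q n : P \is monic -> Q \is monic ->
  size P = n.+1 -> size Q = n.+1 -> (size (P - Q)%R <= n)%N.
Proof.
move=> /monicP + /monicP + sP sQ; rewrite /lead_coef sP sQ /= => lP lQ.
apply/leq_sizeP => k; rewrite leq_eqVlt => /predU1P[<-|nk].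
  by rewrite coefB lP lQ subrr.
by rewrite coefB !nth_default ?subrr ?sP ?sQ.
Qed.

Lemma scale_monic_inj (c c' : F) P Q : P \is monic -> Q \is monic -> c != 0 ->
  c *: P = c' *: Q -> c = c' /\ P = Q.
Proof.
move=> mP mQ c0 E; have Ec : c = c'.
  move: (congr1 lead_coef E).
  by rewrite !lead_coefZ (monicP mP) (monicP mQ) !mulr1.
by split=> //; move: E; rewrite -Ec; apply: scalerI.
Qed.

(** The two sides differ by [(u' - u) *: Q] plus terms of lower degree, so [u = u']; leading
    coefficients then give [c = c']. This is one step of reading off entries. *)
Lemma three_term_inj (u u' c c' : F) Q P P' :
  P \is monic -> P' \is monic -> (size P < size Q)%N -> (size P' < size Q)%N ->
  c != 0 ->
  ('X - u%:P) * Q - c *: P = ('X - u'%:P) * Q - c' *: P' ->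
  [/\ u = u', c = c' & P = P'].
Proof.
move=> mP mP' sP sP' c0 E.
have E1 : (u' - u) *: Q = c *: P - c' *: P'.
  apply/eqP; rewrite -subr_eq0; apply/eqP.
  rewrite -(subrr (('X - u'%:P) * Q - c' *: P')) -{1}E -!mul_polyC polyCB; ring.
have Eu : u = u'.
  apply/eqP; rewrite eq_sym -subr_eq0; apply: contraT => h.
  have : (size ((u' - u) *: Q) < size Q)%N.
    rewrite E1 (leq_ltn_trans (size_polyD _ _)) // gtn_max size_polyN.
    by apply/andP; split; apply: leq_ltn_trans (size_scale_leq _ _) _.
  by rewrite size_scale // ltnn.
move: E1; rewrite Eu subrr scale0r => /esym/eqP; rewrite subr_eq0 => /eqP E1.
by have [-> ->] := scale_monic_inj mP mP' c0 E1.
Qed.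

End JacobiPoly.

(** * Reading off entries, and Hochstadt's theorem *)

Section Peeling.
Variables (F : numFieldType) (b a b' a' : nat -> F).

Definition agree s l :=
  (forall k, (s < k <= s + l.+1)%N -> b k = b' k) /\
  (forall k, (s < k <= s + l)%N -> a k = a' k).

Lemma gt0_sqr_inj (x y : F) : 0 < x -> 0 < y -> x ^+ 2 = y ^+ 2 -> x = y.
Proof.
by move=> x0 y0 /eqP; rewrite eqrXn2 ?ltW // => /eqP.
Qed.

(** The recursion along the first row yields [b s.+1], the square of [a s.+1] and the next smaller
    polynomial, with which the induction continues. Positivity picks the square root. *)
Lemma jacobi_poly_inj_top l s :
  (forall k, (s < k <= s + l)%N -> 0 < a k /\ 0 < a' k) ->
  jacobi_poly b a l.+1 s = jacobi_poly b' a' l.+1 s ->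
  jacobi_poly b a l s.+1 = jacobi_poly b' a' l s.+1 ->
  agree s l.
Proof.
elim: l s => [|l IH] s ha.
  rewrite !jacobi_poly1 => E _; split=> k hk; last by lia.
  have -> : k = s.+1 by lia.
  by move/addrI/oppr_inj/polyC_inj: E.
move=> + E; rewrite !jacobi_polySS E.
have [a0 a0'] : 0 < a s.+1 /\ 0 < a' s.+1 by apply: ha; lia.
case/three_term_inj; rewrite ?jacobi_poly_monic ?size_jacobi_poly //.
  by rewrite expf_neq0 // gt_eqF.
move=> Eb /(gt0_sqr_inj a0 a0') Ea E'.
have [|Hb Ha] := IH s.+1 _ E E'; first by move=> k hk; apply: ha; lia.
split=> k hk; have [->|hks] := eqVneq k s.+1 => //; [apply: Hb | apply: Ha]; lia.
Qed.

(** The mirror image: rows are removed from the bottom, with [s] fixed. *)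
Lemma jacobi_poly_inj_bottom l s :
  (forall k, (s < k <= s + l)%N -> 0 < a k /\ 0 < a' k) ->
  jacobi_poly b a l.+1 s = jacobi_poly b' a' l.+1 s ->
  jacobi_poly b a l s = jacobi_poly b' a' l s ->
  agree s l.
Proof.
elim: l => [|l IH] ha.
  rewrite !jacobi_poly1 => E _; split=> k hk; last by lia.
  have -> : k = s.+1 by lia.
  by move/addrI/oppr_inj/polyC_inj: E.
move=> + E; rewrite !jacobi_polySSr E.
have [a0 a0'] : 0 < a (s + l.+1)%N /\ 0 < a' (s + l.+1)%N by apply: ha; lia.
case/three_term_inj; rewrite ?jacobi_poly_monic ?size_jacobi_poly //.
  by rewrite expf_neq0 // gt_eqF.
move=> Eb /(gt0_sqr_inj a0 a0') Ea E'.
have [|Hb Ha] := IH _ E E'; first by move=> k hk; apply: ha; lia.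
split=> k hk.
  by have [->|hks] := eqVneq k (s + l.+2)%N => //; apply: Hb; lia.
by have [->|hks] := eqVneq k (s + l.+1)%N => //; apply: Ha; lia.
Qed.

(** The numbers [(k - s).*2.-1] and [(k - s).*2] are the positions of [b k] and [a k] in the block's
    own sequence of entries; those beyond position [m] are known. *)
Lemma hochstadt_uniqueness m s :
  (forall k, (s < k < s + m)%N -> 0 < a k /\ 0 < a' k) ->
  (forall k, (s < k <= s + m)%N -> (m < (k - s).*2.-1)%N -> b k = b' k) ->
  (forall k, (s < k < s + m)%N -> (m < (k - s).*2)%N -> a k = a' k) ->
  jacobi_poly b a m s = jacobi_poly b' a' m s ->
  (forall k, (s < k <= s + m)%N -> b k = b' k) /\
  (forall k, (s < k < s + m)%N -> a k = a' k).
Proof.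
case: m => [|[|m]] ha hb haa E; first by split=> k hk; lia.
  have [|Hb _] := @jacobi_poly_inj_bottom 0 s _ E erefl; first by move=> k; lia.
  by split=> k hk; [apply: Hb | ]; lia.
(* The block now has size [m.+2]. The upper part gets the larger half, so that every entry strictly
   below the cut is known. *)
pose i := m.+1./2; pose j := m./2.
have mij : m.+2 = (i.+1 + j.+1)%N by rewrite /i /j; lia.
have [a0 a0'] : 0 < a (s + i.+1)%N /\ 0 < a' (s + i.+1)%N by apply: ha; lia.
move: E; rewrite mij !jacobi_poly_split.
rewrite -(@eq_jacobi_poly _ b a b' a' j.+1 (s + i.+1)); last 2 first.
- by move=> k hk; apply: hb; rewrite /i; lia.
- by move=> k hk; apply: haa; rewrite /i; lia.
rewrite -(@eq_jacobi_poly _ b a b' a' j (s + i.+2)); last 2 first.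
- by move=> k hk; apply: hb; rewrite /i; lia.
- by move=> k hk; apply: haa; rewrite /i; lia.
set A := jacobi_poly b a i.+1 s; set A' := jacobi_poly b' a' i.+1 s.
set B := jacobi_poly b a j.+1 _; set B1 := jacobi_poly b a j _.
set A1 := jacobi_poly b a i s; set A1' := jacobi_poly b' a' i s => E.
pose G := a (s + i.+1)%N ^+ 2 *: A1 - a' (s + i.+1)%N ^+ 2 *: A1'.
have EG : (A - A') * B = G * B1.
  apply/eqP; rewrite -subr_eq0; apply/eqP; move/eqP: E; rewrite -subr_eq0 => /eqP <-.
  by rewrite /G -!mul_polyC; ring.
have sG : (size G <= j.+1)%N.
  (* For even size the degree of [A1] is already small enough. For odd size the entry at the cut is
     among the known ones, and the leading terms of [G] cancel. *)
  have [ij|ij] : i = j \/ i = j.+1 by rewrite /i /j; lia.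
    rewrite (leq_trans (size_polyD _ _)) // geq_max size_polyN.
    by rewrite !(leq_trans (size_scale_leq _ _)) // size_jacobi_poly ij.
  rewrite /G haa; [|by rewrite ?/i; lia..].
  rewrite -scalerBr (leq_trans (size_scale_leq _ _)) // -ij.
  by rewrite size_monicB ?jacobi_poly_monic ?size_jacobi_poly.
have cB : coprimep B B1.
  rewrite /B1 addnS; apply: coprimep_jacobi_poly => k hk.
  by rewrite gt_eqF //; case: (ha k) => //; lia.
have G0 : G = 0.
  apply/eqP; apply: contraTT sG => G0; rewrite -ltnNge.
  have : B %| G by rewrite -(Gauss_dvdpl _ cB) -EG dvdp_mull.
  by move/dvdp_leq => /(_ G0); rewrite size_jacobi_poly.
have EA : A = A'.
  move/eqP: EG; rewrite G0 mul0r mulf_eq0 [B == 0]negbTE ?orbF.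
    by rewrite subr_eq0 => /eqP.
  by rewrite monic_neq0 // jacobi_poly_monic.
(* Since [A1] and [A1'] are monic, [G = 0] gives both the entry at the cut and [A1 = A1']. *)
move/eqP: G0; rewrite subr_eq0 => /eqP /scale_monic_inj.
rewrite !jacobi_poly_monic expf_neq0 ?gt_eqF // => -[] // /(gt0_sqr_inj a0 a0') Ea E1.
have [|Hb Ha] := jacobi_poly_inj_bottom _ EA E1; first by move=> k hk; apply: ha; lia.
split=> k hk.
  have [hk'|hk'] := leqP k (s + i.+1); first by apply: Hb; lia.
  by apply: hb; rewrite /i in hk' *; lia.
have [hk'|hk'|->//] := ltngtP k (s + i.+1); first by apply: Ha; lia.
by apply: haa; rewrite /i in hk' *; lia.
Qed.

End Peeling.

(** * Real blocks have only real eigenvalues *)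

Section Herglotz.
Variables (C : numClosedFieldType) (b a : nat -> C).

Lemma map_jacobi_poly_conj l s :
  (forall k, (s < k <= s + l)%N -> b k \is Num.real) ->
  (forall k, (s < k < s + l)%N -> a k \is Num.real) ->
  map_poly Num.conj (jacobi_poly b a l s) = jacobi_poly b a l s.
Proof.
elim/ltn_ind: l s => -[|[|l]] IH s hb ha.
- by rewrite jacobi_poly0 rmorph1.
- rewrite jacobi_poly1 rmorphB /= map_polyX map_polyC /= conj_Creal // hb //; lia.
rewrite jacobi_polySS rmorphB rmorphM rmorphB /= map_polyX map_polyC /= map_polyZ.
rewrite !IH //; try by [move=> k hk; (apply: hb || apply: ha); lia].
rewrite rmorphXn /= !conj_Creal ?hb ?ha //; lia.
Qed.

(* Up to a positive factor the second term is the imaginary part of the quotient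
   of the two values: this quotient maps the upper half-plane to itself. *)
Lemma jacobi_poly_herglotz l s (w : C) :
  (forall k, (s < k <= s + l.+1)%N -> b k \is Num.real) ->
  (forall k, (s < k <= s + l)%N -> a k \is Num.real) ->
  w \isn't Num.real ->
  0 < 'Im w * 'Im ((jacobi_poly b a l.+1 s).[w] * (jacobi_poly b a l s.+1).[w]^*).
Proof.
move=> + + wNR.
have w2 : 0 < 'Im w * 'Im w.
  rewrite -expr2 -real_normK ?Creal_Im // exprn_gt0 // normr_gt0.
  by apply: contraNneq wNR => /Creal_ImP.
have ImB r : r \is Num.real -> 'Im (w - r) = 'Im w.
  by move=> /Creal_ImP h; rewrite raddfB /= h subr0.
elim: l s => [|l IH] s hb ha.
  rewrite jacobi_poly1 jacobi_poly0 hornerXsubC hornerC rmorph1 mulr1 ImB //.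
  by apply: hb; lia.
have {}IH : 0 < 'Im w * 'Im ((jacobi_poly b a l.+1 s.+1).[w] *
    (jacobi_poly b a l s.+2).[w]^*).
  by apply: IH => k hk; [apply: hb | apply: ha]; lia.
rewrite jacobi_polySS hornerD hornerN hornerM hornerZ hornerXsubC.
set Q := (jacobi_poly b a l.+1 s.+1).[w] in IH *.
set S := (jacobi_poly b a l s.+2).[w] in IH *.
have a2 : a s.+1 ^+ 2 \is Num.real by rewrite rpredX // ha //; lia.
(* After multiplication by ['Im w], the first term is positive and the second nonnegative by
   induction. *)
have -> : 'Im (((w - b s.+1) * Q - a s.+1 ^+ 2 * S) * Q^*) =
    'Im w * `|Q| ^+ 2 + a s.+1 ^+ 2 * 'Im (Q * S^*).
  rewrite mulrBl raddfB /= -mulrA -normCK ImMr ?rpredX ?normr_real // ImB; last first.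
    by apply: hb; lia.
  rewrite -mulrA ImMl // -[Q * _]conjCK Im_conj rmorphM /= conjCK.
  by rewrite [Q^* * S]mulrC mulrN.
rewrite mulrDr mulrA [X in _ + X]mulrCA ltr_wpDr //.
  by rewrite mulr_ge0 ?(ltW IH) // real_exprn_even_ge0 // ha //; lia.
rewrite pmulr_rgt0 // exprn_gt0 // normr_gt0.
(* If [Q] vanished, the induction hypothesis would read [0 < 0]. *)
by apply: contraTneq IH => ->; rewrite mul0r raddf0 mulr0 ltxx.
Qed.

(** At a non-real root the positive quantity of [jacobi_poly_herglotz] would be zero. *)
Lemma jacobi_poly_real_root l s (w : C) :
  (forall k, (s < k <= s + l)%N -> b k \is Num.real) ->
  (forall k, (s < k < s + l)%N -> a k \is Num.real) ->
  root (jacobi_poly b a l s) w -> w \is Num.real.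
Proof.
case: l => [|l] hb ha /rootP rw; first by move/eqP: rw; rewrite hornerC oner_eq0.
apply/negPn/negP => wNR.
have := jacobi_poly_herglotz hb _ wNR.
rewrite rw mul0r raddf0 mulr0 ltxx => h.
by suff: false by []; apply: h => k hk; apply: ha; lia.
Qed.

End Herglotz.

(** * Separating the spectra of the blocks, and the block with the non-real entry *)

Section Spectrum.
Variable C : numClosedFieldType.

Lemma monic_prod_roots (P : {poly C}) : P \is monic ->
  exists2 r : seq C, P = \prod_(w <- r) ('X - w%:P) & size P = (size r).+1.
Proof.
move=> /monicP mP; have [r] := closed_field_poly_normal P.
by rewrite mP scale1r => Pr; exists r; rewrite // Pr size_prod_XsubC.
Qed.

(** All non-real roots of the product come from [P1], and their number is its degree, so [P1] has no
    real root. The real roots thus belong to [P2], and as many distinct ones as its degree force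
    them to be simple. *)
Lemma spectrum_factors (P1 P2 : {poly C}) (z x : seq C) :
  P1 \is monic -> P2 \is monic ->
  size P1 = (size z).+1 -> size P2 = (size x).+1 ->
  (forall w, root P2 w -> w \is Num.real) ->
  (forall w, count_mem w z = if w \is Num.real then 0%N else mup w (P1 * P2)) ->
  uniq x -> (forall w, (w \in x) = (w \is Num.real) && root (P1 * P2) w) ->
  P1 = \prod_(w <- z) ('X - w%:P) /\ P2 = \prod_(w <- x) ('X - w%:P).
Proof.
move=> /monic_prod_roots[r1 -> ->] /monic_prod_roots[r2 -> ->] [s1] [s2] r2R hz ux hx.
have pz : perm_eq z [seq w <- r1 | w \isn't Num.real].
  apply/allP => w _; rewrite /= hz count_filter; apply/eqP.
  case: ifPn => wR.
    rewrite (@eq_count _ _ pred0) ?count_pred0 // => v /=.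
    by case: eqP => // ->; rewrite wR.
  rewrite mupMl ?mu_prod_XsubC; last by apply: contra wR; apply: r2R.
  by apply: eq_count => v /=; case: eqP => // ->; rewrite wR.
have r1NR : all (fun w => w \isn't Num.real) r1.
  by rewrite all_count -size_filter -(perm_size pz) s1.
have Er1 : perm_eq z r1 by move: pz; rewrite (all_filterP r1NR).
split; first by apply/esym/perm_big.
apply/esym/perm_big.
have xr2 : {subset x <= r2}.
  move=> w; rewrite hx rootM !root_prod_XsubC => /andP[wR /orP[/(allP r1NR)|//]].
  by rewrite wR.
have [_ xEr2] := uniq_min_size ux xr2 (eq_leq s2).
by apply: uniq_perm => //; rewrite -(eq_uniq _ xEr2) ?s2.
Qed.

Lemma nonreal_head_uniqueness (b a b' a' : nat -> C) l s :
  b s.+1 \isn't Num.real ->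
  (forall k, (s.+1 < k <= s + l.+1)%N -> b k \is Num.real /\ b' k \is Num.real) ->
  (forall k, (s < k <= s + l)%N -> 0 < a k /\ 0 < a' k) ->
  jacobi_poly b a l.+1 s = jacobi_poly b' a' l.+1 s ->
  agree b a b' a' s l.
Proof.
move=> b1 hb ha E; apply: (jacobi_poly_inj_top ha E).
(* Conjugation changes only the factor containing the first diagonal entry, as the smaller blocks
   are real. *)
have conj_diff (u v : nat -> C) :
    (forall k, (s.+1 < k <= s + l.+1)%N -> u k \is Num.real) ->
    (forall k, (s < k <= s + l)%N -> 0 < v k) ->
    map_poly Num.conj (jacobi_poly u v l.+1 s) - jacobi_poly u v l.+1 s =
    (u s.+1 - (u s.+1)^*) *: jacobi_poly u v l s.+1.
  move=> hu hv; case: l hu hv {hb ha E} => [|l] hu hv.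
    rewrite jacobi_poly1 jacobi_poly0 rmorphB /= map_polyX map_polyC /=.
    by rewrite -mul_polyC polyCB; ring.
  have vR k : (s < k <= s + l.+1)%N -> v k \is Num.real by move/hv/gtr0_real.
  rewrite jacobi_polySS rmorphB rmorphM rmorphB /= map_polyX map_polyC /= map_polyZ.
  rewrite !map_jacobi_poly_conj; try by move=> k hk; (apply: hu || apply: vR); lia.
  rewrite rmorphXn /= (conj_Creal (vR s.+1 _)); last by lia.
  by rewrite -!mul_polyC polyCB; ring.
have := conj_diff b a; rewrite E conj_diff; last 2 first.
- by move=> k /hb[].
- by move=> k /ha[].
(* The scalar for [b] is nonzero because [b s.+1] is non-real, so the monic factors agree. *)
move=> /(_ (fun k hk => proj1 (hb k hk)) (fun k hk => proj1 (ha k hk))) /esym.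
case/scale_monic_inj; rewrite ?jacobi_poly_monic //.
by apply: contra b1; rewrite subr_eq0 eq_sym => /eqP/CrealP.
Qed.

End Spectrum.

(** * Assembling the two blocks *)

Local Open Scope complex_scope.

Theorem theorem5p6 (R : realType) (n p : nat) (hp : (1 <= p <= n - 1)%N)
    (b a b' a' : nat -> R[i])
    (hJ : admissible n p b a) (hJ' : admissible n p b' a')
    (z : p.-tuple R[i]) (x : (n - p).-tuple R[i])
    (hz : nonreal_eigenvalues (tridiag n b a) z)
    (hz' : nonreal_eigenvalues (tridiag n b' a') z)
    (hx : distinct_real_eigenvalues (tridiag n b a) x)
    (hx' : distinct_real_eigenvalues (tridiag n b' a') x)
    (hc : forall k, (p + n + 1 <= k <= 2 * n - 1)%N ->
      centry b a k = centry b' a' k) :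
  tridiag n b a = tridiag n b' a'.
Proof.
have blocks u v : admissible n p u v ->
    nonreal_eigenvalues (tridiag n u v) z ->
    distinct_real_eigenvalues (tridiag n u v) x ->
    jacobi_poly u v p 0 = \prod_(w <- z) ('X - w%:P) /\
    jacobi_poly u v (n - p) p = \prod_(w <- x) ('X - w%:P).
  case=> _ uR v0 vp hzu [ux hxu].
  have split_char : char_poly (tridiag n u v) =
      jacobi_poly u v p 0 * jacobi_poly u v (n - p) p.
    rewrite char_poly_tridiag.
    (* The cut is placed after row [p], where the cross term vanishes because [v p = 0]. *)
    have {1}-> : n = (p.-1.+1 + (n - p).-1.+1)%N by lia.
    rewrite jacobi_poly_split !prednK ?add0n ?vp; [|lia..].
    by rewrite expr0n scale0r subr0.
  apply: spectrum_factors; rewrite ?jacobi_poly_monic ?size_jacobi_poly ?size_tuple //.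
  - move=> w; apply: jacobi_poly_real_root => k hk; first by apply: uR; lia.
    by rewrite gtr0_real // v0 //; lia.
  - by move=> w; rewrite hzu split_char.
  - by move=> w; rewrite hxu eigenvalue_root_char split_char.
have [P1 P2] := blocks _ _ hJ hz hx; have [P1' P2'] := blocks _ _ hJ' hz' hx'.
case: hJ hJ' => b1 bR a0 ap [_ bR' a0' ap'].
have [||||Hb1 Ha1] := @nonreal_head_uniqueness _ b a b' a' p.-1 0.
- by case: (b 1%N) b1 => r i /= i0; rewrite complex_real gt_eqF.
- by move=> k hk; rewrite bR ?bR' //; lia.
- by move=> k hk; rewrite a0 ?a0' //; lia.
- by rewrite prednK ?P1 //; lia.
have [||||Hb2 Ha2] := @hochstadt_uniqueness _ b a b' a' (n - p) p.
- by move=> k hk; rewrite a0 ?a0' //; lia.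
(* With offset [p] and size [n - p], the bound [n - p < 2 (k - p) - 1] is the same as
   [p + n < 2 k - 1], the range where [c] is given. *)
- move=> k hk1 hk2; have := hc k.*2.-1; rewrite /centry.
  have -> : odd k.*2.-1 by lia.
  have -> : k.*2.-1.+1./2 = k by lia.
  by apply; lia.
- move=> k hk1 hk2; have := hc k.*2; rewrite /centry odd_double doubleK.
  by apply; lia.
- by rewrite P2.
have Hb k : (0 < k <= n)%N -> b k = b' k.
  by move=> hk; have [hkp|hkp] := leqP k p; [apply: Hb1|apply: Hb2]; lia.
have Ha k : (0 < k < n)%N -> a k = a' k.
  move=> hk; have [hkp|hkp|->] := ltngtP k p; last by rewrite ap.
  - by apply: Ha1; lia.
  - by apply: Ha2; lia.
apply/matrixP => i j; rewrite !mxE.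
case: ifP => _; first by apply: Hb; rewrite ltn_ord.
have := ltn_ord i; have := ltn_ord j.
by case: eqP => [->|_]; [|case: eqP => [->|_] //] => *; apply: Ha; lia.
Qed.
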